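(* There exist connected graphs with difference index $2$ but arbitrarily large sum index and girth. That is, for all positive integers $M$ and $g$ there exists a finite simple connected graph $G$ with $\operatorname{dif}(G)=2$, $\operatorname{sum}(G)\geq M$, and finite girth at least $g$.
   Context: For a finite simple graph $G$ and an injective labelling $f:V(G)\to\mathbb{Z}$, define edge labellings $f_+(uv)=f(u)+f(v)$ and $f_-(uv)=|f(u)-f(v)|$ for $uv\in E(G)$. The sum index $\operatorname{sum}(G)$ is the minimum, over all injective $f:V(G)\to\mathbb{Z}$, of the number of distinct values taken by $f_+$ on $E(G)$. The difference index $\operatorname{dif}(G)$ is the minimum, over all injective $f:V(G)\to\mathbb{Z}$, of the number of distinct values taken by $f_-$ on $E(G)$. The girth of a graph is the length of its shortest cycle. *)

(* Defs.v *)
From HB Require Import structures.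
From mathcomp Require Import all_boot all_order all_algebra.
From mathcomp Require Import boolp.

Set Implicit Arguments.
Unset Strict Implicit.
Unset Printing Implicit Defensive.

Import Order.TTheory GRing.Theory Num.Theory.

Record sgraph := SGraph {
  vertex :> finType;
  adj : rel vertex;
  adj_sym : symmetric adj;
  adj_irr : irreflexive adj
}.

Definition connected (G : sgraph) : bool :=
  (0 < #|G|) && [forall u : G, forall v : G, connect (@adj G) u v].

Section Labellings.
Variable G : sgraph.

(* Each edge appears here with both orientations; the two labellings below are
   symmetric in the endpoints, so this does not affect the set of values. *)
Definition darts : seq (G * G) := enum [pred p : G * G | adj p.1 p.2].

Definition sum_label (f : G -> int) (p : G * G) : int := (f p.1 + f p.2)%R.
Definition dif_label (f : G -> int) (p : G * G) : int := `|f p.1 - f p.2|%R.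

Definition num_sums (f : G -> int) : nat :=
  size (undup [seq sum_label f p | p <- darts]).
Definition num_difs (f : G -> int) : nat :=
  size (undup [seq dif_label f p | p <- darts]).

Definition attained (count : (G -> int) -> nat) : pred nat :=
  fun k => `[< exists2 f : G -> int, injective f & count f = k >].

Lemma ex_attained count : exists k, attained count k.
Proof.
pose f (x : G) : int := Posz (enum_rank x).
exists (count f); apply/asboolP; exists f => // x y [] /val_inj.
exact: enum_rank_inj.
Qed.

Definition sum_index : nat := ex_minn (ex_attained num_sums).
Definition dif_index : nat := ex_minn (ex_attained num_difs).

Definition has_cycle (k : nat) : bool :=
  (2 < k) && [exists c : k.-tuple G, ucycleb (@adj G) c].

(* None stands for infinite girth, i.e. an acyclic graph. *)
Definition girth : option nat :=
  if pselect (exists k, has_cycle k) is left ex_cycle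
  then Some (ex_minn ex_cycle) else None.

End Labellings.

(* Main.v *)
(** The graph is a chain of odd cycles of the same length L >= g: the path on
    0, 1, 2, ... together with the chords {tL, tL + L - 1}.  The identity
    labelling only has the differences 1 and L - 1, while one difference would
    force maximum degree 2.  On an odd cycle the edge sums determine the labels
    (twice a label is an alternating sum of edge sums), so with fewer than M
    sums at most M^L of these cycles could carry pairwise distinct labels. *)
Require Import Defs.
From HB Require Import structures.
From mathcomp Require Import all_boot all_order all_algebra.
From mathcomp Require Import boolp.
From mathcomp Require Import zify.

Set Implicit Arguments.
Unset Strict Implicit.
Unset Printing Implicit Defensive.

(** * Neighbours on a cycle, and edge labels *)

Lemma ucycle_two_neighbours (T : eqType) (e : rel T) (c : seq T) (x : T) :
  symmetric e -> ucycle e c -> 2 < size c -> x \in c ->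
  exists y z, [/\ y \in c, z \in c, y != z, e x y & e x z].
Proof.
move=> e_sym /andP[cyc_c uniq_c] size_c /rot_to[i p def_c].
have: cycle e (x :: p) by rewrite -def_c rot_cycle.
have: uniq (x :: p) by rewrite -def_c rot_uniq.
have: 2 < size (x :: p) by rewrite -def_c size_rot.
have in_c : {subset x :: p <= c} by move=> y; rewrite -def_c mem_rot.
case: p {def_c} in_c => [|y [|z s]] //= in_c _ /and3P[_ y_notin _].
rewrite rcons_path => /and3P[exy _ /andP[_ ezx]].
exists y, (last z s); split=> //.
- by apply: in_c; rewrite !inE eqxx orbT.
- by apply: in_c; rewrite 2!in_cons mem_last !orbT.
- by apply: contraNneq y_notin => ->; rewrite mem_last.
- by rewrite e_sym.
Qed.

Lemma mem_sum_label (G : sgraph) (f : G -> int) (u v : G) :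
  adj u v -> (f u + f v)%R \in undup [seq sum_label f p | p <- darts G].
Proof.
by move=> uv; rewrite mem_undup; apply/mapP; exists (u, v); rewrite // mem_enum.
Qed.

Lemma mem_dif_label (G : sgraph) (f : G -> int) (u v : G) :
  adj u v ->
  (`|f u - f v|%R : int) \in undup [seq dif_label f p | p <- darts G].
Proof.
by move=> uv; rewrite mem_undup; apply/mapP; exists (u, v); rewrite // mem_enum.
Qed.

(** If [d] were the only difference, all neighbours of [x] would have labels in
    [{f x - d, f x + d}], which leaves room for only two of them. *)
Lemma two_le_num_difs (G : sgraph) (f : G -> int) (x u v w : G) :
  injective f -> uniq [:: u; v; w] -> adj x u -> adj x v -> adj x w ->
  2 <= num_difs f.
Proof.
move=> f_inj /=; rewrite !inE negb_or -!(inj_eq f_inj) => /and3P[].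
move=> /andP[uv uw] vw _ /(mem_dif_label f) xu /(mem_dif_label f) xv.
move=> /(mem_dif_label f) xw; rewrite leqNgt /num_difs.
apply/negP; move: xu xv xw.
case: (undup _) => [|d [|]] //=; rewrite !inE => /eqP xu /eqP xv /eqP xw _.
move: uv uw vw xu xv xw; lia.
Qed.

(** * The chain of cycles *)

Section CycleChain.

(* The chain has [n.+1] cycles of length [l.+3]. *)
Variables l n : nat.

Definition chain_step (u v : nat) : bool :=
  (v == u.+1) || (l.+3 %| u) && (v == u + l.+2).

(** The number of vertices is [n.+1 * l.+3], written as a successor so that [inord] applies. *)
Definition chain_adj (u v : 'I_(n * l.+3 + l.+2).+1) : bool :=
  chain_step u v || chain_step v u.

Lemma chain_adj_sym : symmetric chain_adj.
Proof. by move=> u v; rewrite /chain_adj orbC. Qed.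

Lemma chain_adj_irr : irreflexive chain_adj.
Proof. by move=> u; rewrite /chain_adj /chain_step; lia. Qed.

Definition cycle_chain := SGraph chain_adj_sym chain_adj_irr.

Definition node (i : nat) : cycle_chain := inord i.

Lemma node_val (u : cycle_chain) : node (val u) = u.
Proof. exact: inord_val. Qed.

Lemma adj_nodeS i : i.+1 <= n * l.+3 + l.+2 -> adj (node i) (node i.+1).
Proof.
move=> le_i; rewrite /= /chain_adj /chain_step !inordK ?eqxx //.
by rewrite ltnS ltnW.
Qed.

Lemma adj_node_chord t :
  t <= n -> adj (node (t * l.+3)) (node (t * l.+3 + l.+2)).
Proof.
move=> le_t; have le_tn : t * l.+3 <= n * l.+3 by rewrite leq_mul2r le_t orbT.
rewrite /= /chain_adj /chain_step !inordK ?dvdn_mull ?eqxx ?orbT //; lia.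
Qed.

Lemma connected_cycle_chain : connected cycle_chain.
Proof.
apply/andP; split; first by rewrite card_ord.
have conn0 i : i <= n * l.+3 + l.+2 -> connect (@adj cycle_chain) (node 0) (node i).
  elim: i => [|i IHi] le_i; first exact: connect0.
  exact: connect_trans (IHi (ltnW le_i)) (connect1 (adj_nodeS le_i)).
have {}conn0 u : connect (@adj cycle_chain) (node 0) u.
  by rewrite -(node_val u); apply: conn0; rewrite -ltnS ltn_ord.
apply/forallP => u; apply/forallP => v; apply: connect_trans (conn0 v).
by rewrite (sym_connect_sym (@adj_sym cycle_chain)); exact: conn0.
Qed.

(** * Difference index *)

Lemma dif_index_cycle_chain : 0 < n -> dif_index cycle_chain = 2.
Proof.
move=> n_gt0; rewrite /dif_index; case: ex_minnP => m /asboolP[f f_inj <-] min_m.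
apply/eqP; rewrite eqn_leq; apply/andP; split.
  apply: min_m; apply/asboolP; exists (fun u => Posz (val u)).
    by move=> u v [/val_inj].
  rewrite /num_difs -[RHS]/(size [:: 1%R; Posz l.+2]).
  apply: perm_size; apply: uniq_perm; rewrite ?undup_uniq // => d.
  apply/idP/idP.
    rewrite mem_undup => /mapP[[u v]]; rewrite mem_enum /dif_label !inE /=.
    rewrite /chain_adj /chain_step => uv ->; move: uv; lia.
  rewrite !inE => /orP[]/eqP->.
    have adj01 : adj (node 0) (node 1) by apply: adj_nodeS; lia.
    have := mem_dif_label (fun u : cycle_chain => Posz (val u)) adj01.
    by rewrite /= !inordK //; lia.
  have := mem_dif_label (fun u : cycle_chain => Posz (val u)) (@adj_node_chord 0 isT).
  by rewrite /= !inordK //; lia.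
have size_n : l.+3 <= n * l.+3 by rewrite leq_pmull.
(* The top of the first cycle has degree 3: its two path neighbours and the other end [0] of its
   chord. The neighbour [l.+3] exists because there is a second cycle. *)
apply: (@two_le_num_difs _ _ (node l.+2) (node l.+1) (node l.+3) (node 0)) => //.
- rewrite /= !inE -!(inj_eq val_inj) /= !inordK; lia.
- by rewrite adj_sym adj_nodeS //; lia.
- by rewrite adj_nodeS //; lia.
- by rewrite adj_sym; exact: (@adj_node_chord 0).
Qed.

(** * Girth *)

(** Chord ends are congruent to [0] or [l.+2] modulo [l.+3], so a vertex at an offset strictly in
    between meets only path edges. *)
Lemma chain_interior_step s i x :
  l.+3 %| s -> 0 < i < l.+2 ->
  chain_step (s + i) x || chain_step x (s + i) ->
  (x == (s + i).+1) || (s + i == x.+1).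
Proof.
move=> dvd_s /andP[i_gt0 lt_i] /orP[]/orP[->|/andP[dvd /eqP def_x]];
  rewrite ?orbT //.
  by move: dvd; rewrite dvdn_addr // => /dvdn_leq-/(_ i_gt0); lia.
have: l.+3 %| s + i.+1.
  by rewrite addnS def_x -addnS dvdn_addr.
by rewrite dvdn_addr // => /dvdn_leq-/(_ isT); lia.
Qed.

(* The top vertex of a cycle has two smaller neighbours, so it ends a chord;
   the vertices strictly under that chord have degree 2, which forces all of
   them into the cycle. *)
Lemma cycle_chain_size_ge (c : seq cycle_chain) :
  ucycle (@adj cycle_chain) c -> 2 < size c -> l.+3 <= size c.
Proof.
move=> cyc_c size_c.
have nbr x : x \in c -> exists y z, [/\ y \in c, z \in c, y != z, adj x y & adj x z].
  exact: ucycle_two_neighbours (@adj_sym cycle_chain) cyc_c size_c.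
have [u0 u0_c] : exists u0, u0 \in c.
  by case: (c) size_c => // u0 s _; exists u0; rewrite mem_head.
case: (@arg_maxnP _ u0 [in c] (fun u : cycle_chain => val u) u0_c).
move=> u u_c max_u.
have [s [dvd_s def_u pred_u]] : exists s, [/\ l.+3 %| s, val u = s + l.+2
    & s + l.+1 \in [seq val v | v <- c]].
  have [y [z [y_c z_c yz]]] := nbr u u_c.
  move: (max_u y y_c) (max_u z z_c) yz; rewrite -(inj_eq val_inj) /=.
  rewrite /chain_adj /chain_step => le_y le_z yz uy uz.
  (* Both neighbours lie below the maximal [u]: one is its predecessor, the other the lower end [s]
     of its chord. *)
  have [y_pred|y_pred] := eqVneq (val u) (val y).+1.
    exists (val z); have [dvd_z def_u] : l.+3 %| z /\ val u = z + l.+2.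
      by move: y_pred; move: le_y le_z yz uy uz => /=; lia.
    by split=> //; apply/mapP; exists y => //; move: def_u y_pred => /=; lia.
  exists (val y); have [dvd_y def_u] : l.+3 %| y /\ val u = y + l.+2.
    by move: y_pred; move: le_y le_z yz uy uz => /=; lia.
  split=> //; apply/mapP; exists z => //.
  by move: y_pred le_y le_z yz uy uz def_u => /=; lia.
(* Descent from the top of the chord; [j = l.+1] reaches [s] itself. *)
have in_c j : j <= l.+1 -> (s + (l.+1 - j) \in [seq val v | v <- c])
    && (s + (l.+2 - j) \in [seq val v | v <- c]).
  elim: j => [_|j IHj lt_j].
    by rewrite !subn0 pred_u -def_u map_f.
  have /andP[in_j _] := IHj (ltnW lt_j); rewrite subSS in_j andbT.
  have /mapP[x x_c def_x] := in_j.
  have int_x : 0 < l.+1 - j < l.+2 by lia.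
  have [y [z [y_c z_c yz]]] := nbr x x_c.
  rewrite /= /chain_adj -def_x => /(chain_interior_step dvd_s int_x) xy.
  move=> /(chain_interior_step dvd_s int_x) xz.
  (* The distinct [y] and [z] both differ from [x] by 1, so one of them is the next vertex down. *)
  have [y_up|y_up] := boolP (s + (l.+1 - j) == y.+1).
    by apply/mapP; exists y => //=; lia.
  apply/mapP; exists z => //; move: yz; rewrite -(inj_eq val_inj) /=; lia.
rewrite -(size_iota s l.+3) -(size_map val c).
apply: uniq_leq_size (iota_uniq _ _) _ => i; rewrite mem_iota => lt_i.
have [i_s|i_s] := leqP i (s + l.+1).
  have ->: i = s + (l.+1 - (l.+1 - (i - s))) by lia.
  by have /in_c/andP[] : l.+1 - (i - s) <= l.+1 by lia.
have ->: i = s + (l.+2 - 0) by lia.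
by have /andP[] := in_c 0 isT.
Qed.

Lemma has_cycle_cycle_chain : has_cycle cycle_chain l.+3.
Proof.
rewrite /has_cycle /=; apply/existsP.
(* The witness is the first cycle, closed by its chord. *)
have size_c : size [seq node i | i <- iota 0 l.+3] == l.+3.
  by rewrite size_map size_iota.
exists (Tuple size_c); apply/andP; split.
  have path_node k i : i + k <= l.+2 ->
      path (@adj cycle_chain) (node i) [seq node j | j <- iota i.+1 k].
    elim: k i => //= k IHk i le_ik; rewrite IHk ?andbT; last by lia.
    by apply: adj_nodeS; lia.
  rewrite -[cycle _ _]/(path (@adj cycle_chain) (node 0)
    (rcons [seq node j | j <- iota 1 l.+2] (node 0))).
  rewrite rcons_path path_node // last_map.
  have -> : last 0 (iota 1 l.+2) = l.+2.
    by rewrite (last_nth 0) size_iota -[_ :: _]/(iota 0 l.+3) nth_iota.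
  by rewrite adj_sym; exact: (@adj_node_chord 0).
rewrite map_inj_in_uniq ?iota_uniq // => i j; rewrite !mem_iota => lt_i lt_j.
by move=> /(congr1 val); rewrite /= !inordK //; lia.
Qed.

Lemma girth_cycle_chain : girth cycle_chain = Some l.+3.
Proof.
rewrite /girth; case: pselect => [ex_c|[]]; last first.
  by exists l.+3; exact: has_cycle_cycle_chain.
case: ex_minnP => k /andP[k_gt2 /existsP[c cyc_c]] min_k; congr Some.
apply/eqP; rewrite eqn_leq min_k ?has_cycle_cycle_chain //=.
by rewrite -(size_tuple c); apply: cycle_chain_size_ge; rewrite ?size_tuple.
Qed.

(** * Sum index *)

Lemma sum_index_cycle_chain M :
  ~~ odd l -> M ^ l.+3 <= n -> M <= sum_index cycle_chain.
Proof.
move=> even_l le_n; rewrite /sum_index.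
case: ex_minnP => m /asboolP[f f_inj <-] _; rewrite leqNgt; apply/negP => lt_M.
case: M lt_M le_n => // M lt_M le_n.
pose S := undup [seq sum_label f p | p <- darts cycle_chain].
(* Cyclic successor of a position within one cycle. *)
pose next_pos (i : nat) : nat := if i == l.+2 then 0 else i.+1.
pose block_sum t i : int := (f (node (t * l.+3 + i)) + f (node (t * l.+3 + next_pos i)))%R.
have block_bound t : t <= n -> t * l.+3 <= n * l.+3.
  by move=> le_t; rewrite leq_mul2r le_t orbT.
have block_sumP t i : t <= n -> i < l.+3 -> block_sum t i \in S.
  move=> le_t lt_i; have le_tn := block_bound t le_t; apply: mem_sum_label.
  rewrite /next_pos; case: eqP => [->|ne_i].
    by rewrite addn0 adj_sym adj_node_chord.
  by rewrite addnS; apply: adj_nodeS; lia.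
(* Each cycle is coded by the positions in [S] of its [l.+3] edge sums. There are more cycles than
   codes, so two distinct cycles have the same sums. *)
pose code (t : 'I_n.+1) : {ffun 'I_l.+3 -> 'I_M.+1} :=
  [ffun i : 'I_l.+3 => inord (index (block_sum t i) S)].
have /injectivePn[t [t' ne_t eq_code]] : ~~ injectiveb code.
  apply/negP => /injectiveP/leq_card.
  by rewrite card_ffun !card_ord leqNgt ltnS le_n.
have eq_sum i : i < l.+3 -> block_sum t i = block_sum t' i.
  move=> lt_i; have inS (r : 'I_n.+1) : block_sum r i \in S.
    by apply: block_sumP => //; rewrite -ltnS.
  move/ffunP/(_ (Ordinal lt_i))/(congr1 val): eq_code; rewrite !ffunE /=.
  (* The indices fit into ['I_M.+1], so [inord] does not fall back to its default. *)
  have index_lt (r : 'I_n.+1) : index (block_sum r i) S < M.+1.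
    by apply: leq_trans lt_M; rewrite ltnS; apply: ltnW; rewrite index_mem.
  rewrite !inordK // => eq_index.
  by rewrite -(nth_index 0%R (inS t)) eq_index nth_index.
(* Equal edge sums make the difference of the two labellings change sign along every edge. *)
pose d i : int := (f (node (t * l.+3 + i)) - f (node (t' * l.+3 + i)))%R.
have d_next i : i < l.+3 -> d (next_pos i) = (- d i)%R.
  by move/eq_sum; rewrite /block_sum /d; lia.
have d_sign i : i < l.+3 -> d i = (if odd i then - d 0 else d 0)%R.
  elim: i => // i IHi lt_i; have := d_next i (ltnW lt_i).
  rewrite /next_pos ifN; last by lia.
  by move=> ->; rewrite (IHi (ltnW lt_i)) /=; case: (odd i); rewrite ?GRing.opprK.
have d0 : d 0 = 0%R.
  (* One turn around the cycle makes [l.+3] sign changes, an odd number. *)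
  suff: (d 0%N = - d 0%N :> int)%R by lia.
  have := d_next l.+2 (leqnn _); rewrite /next_pos eqxx (d_sign l.+2) //=.
  by rewrite negbK (negbTE even_l).
have /f_inj/(congr1 val) :
    f (node (t * l.+3 + 0)) = f (node (t' * l.+3 + 0)) by move: d0; rewrite /d; lia.
have le_t := block_bound t (ltn_ord t); have le_t' := block_bound t' (ltn_ord t').
rewrite !addn0 /= !inordK; try lia.
by move/eqP; rewrite eqn_mul2r /=; apply/negP.
Qed.

End CycleChain.

Theorem theorem2p2 (M g : nat) (hM : 0 < M) (hg : 0 < g) :
  exists G : sgraph,
    [/\ connected G,
        dif_index G = 2,
        M <= sum_index G
      & exists2 k : nat, girth G = Some k & g <= k].
Proof.
(* The even [g.*2] gives cycles of odd length [g.*2.+3], at least [g]; the exponential is the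
   pigeonhole bound, and it is positive, so there are at least two cycles. *)
exists (cycle_chain g.*2 (M ^ g.*2.+3)); split.
- exact: connected_cycle_chain.
- by apply: dif_index_cycle_chain; rewrite expn_gt0 hM.
- by apply: sum_index_cycle_chain; rewrite ?odd_double.
- by exists g.*2.+3; [exact: girth_cycle_chain | lia].
Qed.
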